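(* Let $\mathcal{L}=\sum_{|\alpha|=0}^np_\alpha\partial^\alpha$ be a differential operator with constant real coefficients $p_\alpha$, and let $u$ solve $\partial_tu=-\mathcal{L}u$ on $\Omega\times[0,T]$, $\Omega=\mathbb{T}^d$, with $u(\cdot,0)=u_0$. Let $Q=\{\zeta\in\mathbb{Z}^d:\widehat{u}_0(\zeta)\ne0\}$. If $$|Q|\ge\max\left(\sum_{k=0}^{\lfloor n/2\rfloor}\binom{2k+d-1}{d-1},\ \sum_{k=0}^{\lfloor (n-1)/2\rfloor}\binom{2k+d}{d-1}\right)$$ and $Q$ is not located on an algebraic polynomial hypersurface of degree $\le n$ consisting of only even order terms or only odd order terms, then the parameters $p_\alpha$ are uniquely determined by the solution at two instants $u(x,t_2),u(x,t_1)$ if $|t_2-t_1|$ is small enough.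
   Context: $\Omega=\mathbb{T}^d=\mathbb{R}^d/(2\pi\mathbb{Z})^d$, and $\widehat{u}(\zeta,t)=(2\pi)^{-d/2}\int_\Omega e^{-i\zeta\cdot x}u(x,t)\,dx$, $\zeta\in\mathbb{Z}^d$, is the Fourier transform in the space variable; $\widehat u_0$ is that of $u_0$. The hypersurface condition means that no nonzero polynomial of degree $\le n$ whose monomials all have even total degree, or all have odd total degree, vanishes on all of $Q$. *)

(* Defs.v *)
From HB Require Import structures.
From mathcomp Require Import all_boot all_order all_algebra.
From mathcomp Require Import complex.
From mathcomp Require mpoly.
From mathcomp Require Import all_classical all_reals all_analysis.
Import numFieldNormedType.Exports.
(* The notations of mpoly clash with those of mathcomp-analysis. *)
Export (canonicals, coercions) mpoly.

Set Implicit Arguments.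
Unset Strict Implicit.
Unset Printing Implicit Defensive.

Import Order.TTheory GRing.Theory Num.Theory.
Local Open Scope classical_set_scope.
Local Open Scope ring_scope.
Local Open Scope complex_scope.

(* Functions on the torus R^d / (2 pi Z)^d are periodic functions on R^d. *)
Definition torus_periodic (R : realType) (d : nat) (X : Type)
    (f : 'rV[R]_d -> X) : Prop :=
  forall (x : 'rV[R]_d) (k : 'rV[int]_d),
    f (x + (2 * pi) *: map_mx intr k) = f x.

(* Integral over [0, 2 pi]^d as an iterated integral; it is only applied to
   the real and imaginary parts of continuous functions. *)
Fixpoint torus_int (R : realType) (d : nat) : ('rV[R]_d -> R) -> R :=
  match d with
  | 0 => fun f => f 0
  | d'.+1 => fun f =>
      \int[lebesgue_measure]_(s in `[0, 2 * pi])
        torus_int (fun y : 'rV[R]_d' => f (row_mx (s%:M : 'rV[R]_1) y))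
  end.

Definition torus_intC (R : realType) (d : nat) (f : 'rV[R]_d -> R[i]) : R[i] :=
  torus_int (fun x => complex.Re (f x)) +i* torus_int (fun x => complex.Im (f x)).

Definition expi (R : realType) (theta : R) : R[i] := cos theta +i* sin theta.

Definition fourier (R : realType) (d : nat) (f : 'rV[R]_d -> R[i])
    (zeta : 'rV[int]_d) : R[i] :=
  ((2 * pi) `^ (- (d%:R / 2)))%:C *
  torus_intC (fun x => expi (- \sum_i (zeta 0 i)%:~R * x 0 i) * f x).

(* [mpoly.bmultinom d n.+1] is the finite type of multi-indices alpha in N^d
   with |alpha| <= n. *)
Definition coefs (R : realType) (d n : nat) : Type :=
  {ffun mpoly.bmultinom d n.+1 -> R}.

(* [pderiv [:: i1; ...; ik] f] is the iterated partial derivative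
   d_i1 (... (d_ik f)); derivatives are total operators, differentiability is
   required separately in [classical_solution]. *)
Definition pderiv (R : realType) (d : nat) (s : seq 'I_d) (f : 'rV[R]_d -> R) :
    'rV[R]_d -> R :=
  foldr (fun i g => fun x => 'D_(delta_mx 0 i) g x) f s.

Definition mnm_seq (d : nat) (a : mpoly.multinom d) : seq 'I_d :=
  flatten [seq nseq (a i) i | i <- enum 'I_d].

Definition diffop (R : realType) (d n : nat) (p : coefs R d n)
    (f : 'rV[R]_d -> R) (x : 'rV[R]_d) : R :=
  \sum_(a : mpoly.bmultinom d n.+1) p a * pderiv (mnm_seq a) f x.

(* All partial derivatives in x of order <= n, taken in any order of the
   variables, exist and are jointly continuous for 0 < t < T; the solution
   itself is continuous up to t = 0 and t = T. *)
Definition classical_solution (R : realType) (d n : nat) (p : coefs R d n)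
    (T : R) (u : 'rV[R]_d -> R -> R) : Prop :=
  [/\ {within [set z : 'rV[R]_d * R | 0 <= z.2 <= T],
        continuous (fun z => u z.1 z.2)},
      forall (s : seq 'I_d) (i : 'I_d) (x : 'rV[R]_d) (t : R),
        (size s < n)%N -> 0 < t < T ->
        derivable (pderiv s (u ^~ t)) x (delta_mx 0 i),
      forall s : seq 'I_d, (size s <= n)%N ->
        {within [set z : 'rV[R]_d * R | 0 < z.2 < T],
          continuous (fun z => pderiv s (u ^~ z.2) z.1)} &
      forall (x : 'rV[R]_d) (t : R), 0 < t < T ->
        is_derive t (1 : R) (u x) (- diffop p (u ^~ t) x)].

(* The coefficients are real, so the complex equation is the conjunction of the
   equations for the real and imaginary parts. *)
Definition solves (R : realType) (d n : nat) (p : coefs R d n) (T : R)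
    (u : 'rV[R]_d -> R -> R[i]) : Prop :=
  [/\ forall t, 0 <= t <= T -> torus_periodic (u ^~ t),
      classical_solution p T (fun x t => complex.Re (u x t)) &
      classical_solution p T (fun x t => complex.Im (u x t))].

Definition on_parity_hypersurface (R : realType) (d n : nat)
    (Q : set 'rV[int]_d) : Prop :=
  exists P : mpoly.mpoly d R,
    [/\ P != 0,
        (forall m, m \in mpoly.msupp P -> (mpoly.mdeg m <= n)%N),
        (forall m, m \in mpoly.msupp P -> ~~ odd (mpoly.mdeg m)) \/
        (forall m, m \in mpoly.msupp P -> odd (mpoly.mdeg m)) &
        forall zeta, Q zeta -> mpoly.meval (fun i => (zeta 0 i)%:~R) P = 0].

(* Main.v *)
Require Import Defs.
From mathcomp Require Import all_boot all_order all_algebra.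
From mathcomp Require Import complex.
From mathcomp Require mpoly.
From mathcomp Require Import all_classical all_reals all_analysis.
From mathcomp Require Import ring lra.
Import numFieldNormedType.Exports.
Import Order.TTheory GRing.Theory Num.Theory.
Local Open Scope classical_set_scope.
Local Open Scope card_scope.
Local Open Scope ring_scope.
Local Open Scope complex_scope.
Set Implicit Arguments.
Unset Strict Implicit.
Unset Printing Implicit Defensive.

(** Why the theorem holds. The operator has constant coefficients and u is
    periodic, so integration by parts shows that the Fourier coefficient of L u
    at zeta is the symbol sigma_p(zeta) = sum_a p_a (i zeta)^a times that of u
    ([fmode_diffop]). Differentiating under the integral sign, each coefficient
    of a solution satisfies a scalar linear ODE on ]0, T[ and is continuous on
    [0, T], hence exp(t sigma_p(zeta)) uhat(zeta, t) does not depend on t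
    ([fourier_evolution]).

    Two solutions that agree at t1 and t2, for the parameters p and q, thus
    satisfy exp((t2 - t1) sigma_p) = exp((t2 - t1) sigma_q) at every frequency
    zeta of Q, where these coefficients do not vanish ([symbols_eq]). Taking
    moduli, the real parts of the two symbols agree on Q; the imaginary parts
    agree modulo 2 pi / (t2 - t1), so they agree where their difference is known
    to be smaller than this period.

    The real part of sigma_p - sigma_q is a polynomial in zeta with monomials of
    even degree only, the imaginary part one with monomials of odd degree only,
    and the coefficients are +-(p_a - q_a). The first vanishes on Q, so it is
    zero by the hypersurface condition ([parity_coef0]), and p_a = q_a for |a|
    even. For the second, Q may be infinite and the difference of the symbols
    unbounded on it; but polynomials of degree at most n form a
    finite-dimensional space, so vanishing on a suitable finite part of Q
    implies vanishing on Q ([finite_test]). On this finite part the difference of the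
    symbols is bounded in terms of the bound M on the coefficients only, which
    gives the threshold delta on |t2 - t1|.

    The integral over the torus is an iterated one-dimensional integral, and its
    properties are proved by induction on the dimension: continuity with respect
    to a parameter in an arbitrary topological space ([torus_int_cts]), which
    yields linearity and the bound [torus_int_bound], then Leibniz' rule
    ([torus_int_leibniz]) and the vanishing of the integral of a partial
    derivative of a periodic function ([torus_int_derive]). *)

(** * Continuity *)

Section TorusIntegral.
Context {R : realType}.

Lemma cvg_matrix (I : Type) (F : set_system I) m n (f : I -> 'M[R]_(m, n))
    (M : 'M[R]_(m, n)) : Filter F ->
  (forall i j, (fun t => f t i j) @ F --> M i j) -> f @ F --> M.
Proof.
move=> FF fM A [P nP PA].
have : \forall t \near F, forall i j, P i j (f t i j).
  by apply: filter_forall => i; apply: filter_forall => j; exact: (fM i j).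
by apply: filterS => t Pt; exact: PA.
Qed.

Lemma cts_comp (X U V : topologicalType) (g : U -> V) (f : X -> U) :
  continuous g -> continuous f -> continuous (fun x => g (f x)).
Proof. by move=> cg cf x; apply: continuous_comp; [exact: cf|exact: cg]. Qed.

Lemma cts_pair (X U V : topologicalType) (f : X -> U) (g : X -> V) :
  continuous f -> continuous g -> continuous (fun x => (f x, g x)).
Proof. by move=> cf cg x; apply: cvg_pair; [exact: cf|exact: cg]. Qed.

Lemma cts_id (X : topologicalType) : continuous (fun x : X => x).
Proof. by move=> x. Qed.

Lemma cts_cst (X U : topologicalType) (u : U) : continuous (fun _ : X => u).
Proof. by move=> x; exact: cvg_cst. Qed.

Lemma cts_fst (U V : topologicalType) : continuous (fun z : U * V => z.1).
Proof. by move=> z; exact: cvg_fst. Qed.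

Lemma cts_snd (U V : topologicalType) : continuous (fun z : U * V => z.2).
Proof. by move=> z; exact: cvg_snd. Qed.

Lemma ctsD (X : topologicalType) (f g : X -> R) :
  continuous f -> continuous g -> continuous (fun x => f x + g x).
Proof. by move=> cf cg x; apply: cvgD; [exact: cf|exact: cg]. Qed.

Lemma ctsB (X : topologicalType) (f g : X -> R) :
  continuous f -> continuous g -> continuous (fun x => f x - g x).
Proof. by move=> cf cg x; apply: cvgB; [exact: cf|exact: cg]. Qed.

Lemma ctsN (X : topologicalType) (f : X -> R) :
  continuous f -> continuous (fun x => - f x).
Proof. by move=> cf x; apply: cvgN; exact: cf. Qed.

Lemma ctsM (X : topologicalType) (f g : X -> R) :
  continuous f -> continuous g -> continuous (fun x => f x * g x).
Proof. by move=> cf cg x; apply: cvgM; [exact: cf|exact: cg]. Qed.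

Lemma ctsZ (X : topologicalType) (f : X -> R) (c : R) :
  continuous f -> continuous (fun x => c * f x).
Proof. by move=> cf; apply: ctsM => //; exact: cts_cst. Qed.

Lemma cts_slice (X P : topologicalType) (g : X -> P -> R) (p : P) :
  (forall x, {for (x, p), continuous (fun z => g z.1 z.2)}) ->
  continuous (g ^~ p).
Proof.
move=> gc x; apply: (@continuous_comp _ _ _ (fun x => (x, p))
  (fun z => g z.1 z.2)); last exact: gc.
by move: x; apply: cts_pair; [exact: cts_id|exact: cts_cst].
Qed.

Lemma cts_at_sum (X : topologicalType) (I : Type) (r : seq I)
    (f : I -> X -> R) (x : X) : (forall i, {for x, continuous (f i)}) ->
  {for x, continuous (fun y => \sum_(i <- r) f i y)}.
Proof.
move=> fc; elim: r => [|i r IH].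
  rewrite (_ : (fun y => _) = fun=> 0); first exact: cst_continuous.
  by apply/funext => y; rewrite big_nil.
rewrite (_ : (fun y => _) = fun y => f i y + \sum_(i <- r) f i y).
  by apply: continuousD; [exact: fc|exact: IH].
by apply/funext => y; rewrite big_cons.
Qed.

Lemma cts_sum (X : topologicalType) (I : Type) (r : seq I) (f : I -> X -> R) :
  (forall i, continuous (f i)) -> continuous (fun x => \sum_(i <- r) f i x).
Proof. by move=> fc x; apply: cts_at_sum => i; exact: fc. Qed.

Lemma cts_within_comp (X U V : topologicalType) (D : set U) (f : U -> V)
    (g : X -> U) : {within D, continuous f} -> continuous g ->
  (forall x, D (g x)) -> continuous (fun x => f (g x)).
Proof.
move=> /subspace_continuousP fc gc gD x A fA.
have fA' : nbhs (g x) [set y | D y -> A (f y)] := fc (g x) (gD x) A fA.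
have gA : nbhs x [set y | D (g y) -> A (f (g y))] := gc x _ fA'.
by apply: filterS gA => y; apply; exact: gD.
Qed.

Lemma cts_within_open (U V : topologicalType) (D : set U) (f : U -> V) x :
  {within D, continuous f} -> open D -> D x -> {for x, continuous f}.
Proof.
move=> /subspace_continuousP fc oD Dx A fA.
have fA' : nbhs x [set y | D y -> A (f y)] := fc x Dx A fA.
have nD : nbhs x D by exact: open_nbhs_nbhs.
rewrite -[_ A]/(nbhs x [set y | A (f y)]).
by apply: filterS (filterI fA' nD) => y [/= Af Dy]; exact: Af.
Qed.

(** * The iterated integral over the torus *)

Definition cons_rV {d} (s : R) (y : 'rV[R]_d) : 'rV[R]_d.+1 :=
  row_mx (s%:M : 'rV[R]_1) y.

Lemma cons_rV0 d (s : R) (y : 'rV[R]_d) : cons_rV s y 0 0 = s.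
Proof.
have -> : (0 : 'I_d.+1) = lshift d (0 : 'I_1) by apply/val_inj.
by rewrite [LHS](row_mxEl (s%:M : 'rV[R]_1)) mxE eqxx mulr1n.
Qed.

Lemma cons_rVS d (s : R) (y : 'rV[R]_d) j : cons_rV s y 0 (lift 0 j) = y 0 j.
Proof.
have -> : lift 0 j = rshift 1 j by apply/val_inj.
by rewrite [LHS](row_mxEr (s%:M : 'rV[R]_1)).
Qed.

Lemma cons_rV_eq d (s : R) (y : 'rV[R]_d) (z : 'rV[R]_d.+1) :
  z 0 0 = s -> (forall j, z 0 (lift 0 j) = y 0 j) -> cons_rV s y = z.
Proof.
move=> z0 zS; apply/rowP => i; case: (unliftP 0 i) => [j ->|->].
  by rewrite cons_rVS zS.
by rewrite cons_rV0 z0.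
Qed.

Lemma cts_cons_rV (X : topologicalType) d (s : X -> R) (y : X -> 'rV[R]_d) :
  continuous s -> continuous y -> continuous (fun x => cons_rV (s x) (y x)).
Proof.
move=> cs cy x; apply: cvg_matrix => i j; rewrite ord1.
case: (unliftP 0 j) => [k ->|->].
  rewrite cons_rVS; under eq_fun do rewrite cons_rVS.
  apply: (@cts_comp _ _ _ (fun M : 'rV[R]_d => M 0 k) y) => //.
  exact: coord_continuous.
by rewrite cons_rV0; under eq_fun do rewrite cons_rV0; exact: cs.
Qed.

Definition cube {d} : set 'rV[R]_d :=
  [set x | forall i, `[0, 2 * pi]%classic (x 0 i)].

Lemma compact_cube d : compact (@cube d).
Proof.
apply: (@rV_compact R d (fun=> `[0, 2 * pi]%classic)) => i.
exact: segment_compact.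
Qed.

(** The tube lemma: continuity at the points of K x {p0} is uniform over the
    compact K. *)
Lemma near_compact_unif (X P : topologicalType) (K : set X) (h : X -> P -> R)
    (p0 : P) (e : R) : compact K -> 0 < e ->
  (forall x, K x -> {for (x, p0), continuous (fun z => h z.1 z.2)}) ->
  \forall p \near p0, forall x, K x -> `|h x p - h x p0| < e.
Proof.
move=> /compact_near_coveringP Kc e0 hc.
apply: (Kc P (nbhs p0) (fun p x => `|h x p - h x p0| < e)) => x Kx.
have e20 : 0 < e / 2 by rewrite divr_gt0.
have /cvgrPdist_lt /(_ _ e20) [[A B] /= [nA nB] AB] := hc x Kx.
exists (A, B) => //= -[y p] /= [Ay Bp].
have := AB (y, p) (conj Ay Bp).
have := AB (y, p0) (conj Ay (nbhs_singleton nB)).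
move=> /= h1 h2; rewrite (splitr e).
have -> : h y p - h y p0 = (h x p0 - h y p0) - (h x p0 - h y p) by ring.
by rewrite (le_lt_trans (ler_normB _ _))// ltrD.
Qed.

Let seg : set R := `[0, 2 * pi]%classic.

Let mseg : measurable (seg : set (measurableTypeR R)).
Proof. exact: measurable_itv. Qed.

Lemma seg_integrable (f : R -> R) : continuous f ->
  lebesgue_measure.-integrable seg (EFin \o f).
Proof.
move=> cf; apply: continuous_compact_integrable; first exact: segment_compact.
exact: continuous_subspaceT.
Qed.

Lemma seg_bound (f : R -> R) (M : R) : continuous f ->
  (forall s, seg s -> `|f s| <= M) ->
  `|\int[lebesgue_measure]_(s in seg) f s| <= 2 * pi * M.
Proof.
move=> cf fM; have pi0 := pi_ge0 R.
apply: le_trans (le_normr_Rintegral mseg (seg_integrable cf)) _.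
have -> : 2 * pi * M = \int[lebesgue_measure]_(s in seg) M.
  rewrite Rintegral_cst//= lebesgue_measure_itv/= lte_fin.
  case: ifPn => [_|]; first by rewrite /= subr0 mulrC.
  by rewrite mulr_gt0// pi_gt0.
apply: le_Rintegral => //.
- by apply: seg_integrable => s; apply: cvg_norm; exact: cf.
- by apply: seg_integrable => s; exact: cvg_cst.
Qed.

(** The parameter space is arbitrary so that the induction on d can add the
    outermost variable of integration to the parameters of the inner one. *)
Lemma torus_int_cts d (P : topologicalType) (h : 'rV[R]_d -> P -> R) :
  continuous (fun z => h z.1 z.2) -> continuous (fun p => torus_int (h ^~ p)).
Proof.
elim: d P h => [|d IH] P h hc.
  apply: (@cts_comp _ _ _ (fun z => h z.1 z.2) (fun p => (0, p))) => //.
  by apply: cts_pair; [exact: cts_cst|exact: cts_id].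
(* Integrate the inner variables first, with (s, p) as parameter. *)
pose G (s : R) (p : P) := torus_int (fun y => h (cons_rV s y) p).
have Gc : continuous (fun z => G z.1 z.2).
  apply: (IH (R * P)%type (fun y z => h (cons_rV z.1 y) z.2)).
  apply: (@cts_comp _ _ _ (fun z => h z.1 z.2)
    (fun z : 'rV[R]_d * (R * P) => (cons_rV z.2.1 z.1, z.2.2))) => //.
  apply: cts_pair; last by apply: (cts_comp (@cts_snd _ _)); exact: cts_snd.
  apply: cts_cons_rV; last exact: cts_fst.
  by apply: (cts_comp (@cts_fst _ _)); exact: cts_snd.
have Gs p : continuous (G ^~ p).
  apply: (@cts_comp _ _ _ (fun z => G z.1 z.2) (fun s => (s, p))) => //.
  by apply: cts_pair; [exact: cts_id|exact: cts_cst].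
move=> p0 /=; apply/cvgrPdist_le => e e0.
have pi0 : 0 < 2 * pi :> R by rewrite mulr_gt0// pi_gt0.
have d0 : 0 < e / (2 * pi) by rewrite divr_gt0.
have := @near_compact_unif _ _ _ G p0 _ (@segment_compact R 0 (2 * pi)) d0
  (fun x _ => Gc (x, p0)).
apply: filterS => p hp.
have -> : e = 2 * pi * (e / (2 * pi)) by rewrite mulrC divfK// gt_eqF.
rewrite -[X in `|X|]/(\int[lebesgue_measure]_(s in seg) G s p0 -
  \int[lebesgue_measure]_(s in seg) G s p).
rewrite -RintegralB//; [|exact: seg_integrable|exact: seg_integrable].
apply: seg_bound; first by move=> s; apply: cvgB; exact: Gs.
by move=> s /hp /ltW; rewrite distrC.
Qed.

Lemma cts_cons d (f : 'rV[R]_d.+1 -> R) s :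
  continuous f -> continuous (fun y => f (cons_rV s y)).
Proof.
move=> cf; apply: (cts_comp cf).
by apply: cts_cons_rV; [exact: cts_cst|exact: cts_id].
Qed.

Lemma torus_int_slice_cts d (f : 'rV[R]_d.+1 -> R) : continuous f ->
  continuous (fun s => torus_int (fun y => f (cons_rV s y))).
Proof.
move=> cf; apply: (@torus_int_cts d R (fun y s => f (cons_rV s y))).
apply: (cts_comp cf).
by apply: cts_cons_rV; [exact: cts_snd|exact: cts_fst].
Qed.

Lemma torus_intD d (f g : 'rV[R]_d -> R) : continuous f -> continuous g ->
  torus_int (fun x => f x + g x) = torus_int f + torus_int g.
Proof.
elim: d f g => [//|d IH] f g cf cg /=.
under eq_Rintegral do
  rewrite (IH _ _ (@cts_cons _ _ _ cf) (@cts_cons _ _ _ cg)).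
by rewrite RintegralD//; apply: seg_integrable; exact: torus_int_slice_cts.
Qed.

Lemma torus_intZ d (f : 'rV[R]_d -> R) c : continuous f ->
  torus_int (fun x => c * f x) = c * torus_int f.
Proof.
elim: d f => [//|d IH] f cf /=.
under eq_Rintegral do rewrite (IH _ (@cts_cons _ _ _ cf)).
by rewrite RintegralZl//; apply: seg_integrable; exact: torus_int_slice_cts.
Qed.

Lemma torus_int0 d : torus_int (fun _ : 'rV[R]_d => 0) = 0.
Proof.
elim: d => [//|d IH] /=; under eq_Rintegral do rewrite IH.
by rewrite Rintegral_cst//= mul0r.
Qed.

Lemma torus_int_bound d (f : 'rV[R]_d -> R) (M : R) : continuous f ->
  (forall x, cube x -> `|f x| <= M) -> `|torus_int f| <= (2 * pi) ^+ d * M.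
Proof.
elim: d f => [|d IH] f cf fM /=; first by rewrite mul1r; apply: fM => -[].
rewrite exprS -mulrA; apply: seg_bound; first exact: torus_int_slice_cts.
move=> s ss; apply: IH; first exact: cts_cons.
move=> y yc; apply: fM => i; case: (unliftP 0 i) => [j ->|->].
  rewrite [X in _ X](_ : _ = y 0 j); first exact: yc.
  exact: (cons_rVS s y j).
by rewrite [X in _ X](_ : _ = s)//; exact: (cons_rV0 s y).
Qed.

End TorusIntegral.

(** * Leibniz' rule and integrals of derivatives *)

Section Leibniz.
Context {R : realType}.

Lemma torus_intN d (f : 'rV[R]_d -> R) : continuous f ->
  torus_int (fun x => - f x) = - torus_int f.
Proof.
move=> cf; rewrite -mulN1r -torus_intZ//.
by congr torus_int; apply/funext => x; rewrite mulN1r.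
Qed.

Lemma torus_intB d (f g : 'rV[R]_d -> R) : continuous f -> continuous g ->
  torus_int (fun x => f x - g x) = torus_int f - torus_int g.
Proof.
move=> cf cg; rewrite torus_intD ?torus_intN//.
exact: ctsN.
Qed.

Lemma is_derive_cvg (V : normedModType R) (f : V -> R) (x v : V) (l : R) :
  h^-1 *: (f (h *: v + x) - f x) @[h --> 0^'] --> l -> is_derive x v f l.
Proof.
by move=> fl; apply: DeriveDef; [apply: cvgP fl|apply: cvg_lim fl].
Qed.

(** The mean value theorem with an increment h of either sign. *)
Lemma MVT_ball (f f' : R -> R) (t0 r h : R) : `|h| < r ->
  (forall t, `|t - t0| < r -> is_derive t 1 f (f' t)) ->
  exists2 c, `|c - t0| <= `|h| & f (h + t0) - f t0 = f' c * h.
Proof.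
move=> hr fd.
have fc (a b : R) : (forall t, a <= t <= b -> `|t - t0| < r) ->
    {within `[a, b], continuous f}.
  move=> ab; apply: derivable_within_continuous => t; rewrite in_itv /= => tab.
  by have [] := fd t (ab t tab).
case: (leP 0 h) => h0.
- have hin t : t0 <= t <= h + t0 -> `|t - t0| <= `|h|.
    by move=> /andP[t1 t2]; rewrite !ger0_norm; lra.
  have [] := @MVT_segment R f f' t0 (h + t0).
  + by lra.
  + move=> t; rewrite in_itv /= => /andP[t1 t2]; apply: fd.
    by apply: le_lt_trans hr; apply: hin; rewrite !ltW.
  + by apply: fc => t tt; apply: le_lt_trans hr; exact: hin.
  + move=> c; rewrite in_itv /= => ct ->; exists c; first exact: hin.
    by rewrite addrK.
- have hin t : h + t0 <= t <= t0 -> `|t - t0| <= `|h|.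
    by move=> /andP[t1 t2]; rewrite ler0_norm ?ltr0_norm; lra.
  have [] := @MVT_segment R f f' (h + t0) t0.
  + by lra.
  + move=> t; rewrite in_itv /= => /andP[t1 t2]; apply: fd.
    by apply: le_lt_trans hr; apply: hin; rewrite !ltW.
  + by apply: fc => t tt; apply: le_lt_trans hr; exact: hin.
  + move=> c; rewrite in_itv /= => ct e; exists c; first exact: hin.
    by rewrite -[LHS]opprB e opprD addrCA subrr addr0 mulrN opprK.
Qed.

(** By the mean value theorem the difference quotient at x is f' x c with c
    close to t0; as the cube is compact it tends to f' x t0 uniformly in x, and
    the integral is bounded by the supremum. *)
Lemma torus_int_leibniz d (f f' : 'rV[R]_d -> R -> R) (t0 r : R) : 0 < r ->
  (forall x t, `|t - t0| < r -> is_derive t 1 (f x) (f' x t)) ->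
  (forall t, `|t - t0| < r -> continuous (f ^~ t)) ->
  (forall x, {for (x, t0), continuous (fun z => f' z.1 z.2)}) ->
  is_derive t0 1 (fun t => torus_int (f ^~ t)) (torus_int (f' ^~ t0)).
Proof.
move=> r0 fd fc f'c.
have f'0 : continuous (f' ^~ t0) by exact: cts_slice.
apply: is_derive_cvg; apply/cvgrPdist_le => e e0.
have K0 : 0 < (2 * pi) ^+ d :> R by rewrite exprn_gt0// mulr_gt0// pi_gt0.
have eK : 0 < e / (2 * pi) ^+ d by rewrite divr_gt0.
have /nbhs_ballP[r1 /= r10 fr1] := @near_compact_unif _ _ _ _ f' t0 _
  (@compact_cube R d) eK (fun x _ => f'c x).
have r20 : 0 < Num.min r r1 by rewrite lt_min r0.
near=> h.
have h0 : h != 0 by near: h; exact: nbhs_dnbhs_neq.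
have hr : `|h| < Num.min r r1.
  near: h; apply: dnbhs0_lt; exact: r20.
move: hr; rewrite lt_min => /andP[hr hr1].
have hc : continuous (f ^~ (h *: 1 + t0)).
  by apply: fc; rewrite [_ *: _]mulr1 addrK.
have c0 : continuous (f ^~ t0) by apply: fc; rewrite subrr normr0.
have cB : continuous (fun x => f x (h *: 1 + t0) - f x t0).
  exact: ctsB.
have cZ : continuous (fun x => h^-1 * (f x (h *: 1 + t0) - f x t0)).
  exact: ctsZ.
rewrite -(torus_intB hc c0) -[_ *: _]/(_ * _) -(torus_intZ _ cB).
rewrite -(torus_intB f'0 cZ).
have -> : e = (2 * pi) ^+ d * (e / (2 * pi) ^+ d).
  by rewrite mulrC divfK// gt_eqF.
apply: torus_int_bound.
  exact: ctsB.
move=> x xc; rewrite [_ *: _]mulr1.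
have [c ch ->] := MVT_ball hr (fd x).
rewrite mulrC mulfK// distrC ltW//; apply: fr1 => //.
by rewrite /ball /= distrC; apply: le_lt_trans ch hr1.
Unshelve. all: by end_near. Qed.

(** For an inner variable, apply the induction hypothesis to each slice. For
    the outermost variable, Leibniz' rule shows that the integral over the other
    variables of the derivative is itself the derivative of a periodic function
    of one variable, whose integral over a period vanishes. No exchange of the
    order of integration is needed. *)
Lemma torus_int_derive d (f : 'rV[R]_d -> R) (i : 'I_d) :
  continuous f -> torus_periodic f ->
  (forall x, derivable f x (delta_mx 0 i)) ->
  continuous ('D_(delta_mx 0 i) f) ->
  torus_int ('D_(delta_mx 0 i) f) = 0.
Proof.
elim: d f i => [f [] //|d IH f i fc fp fd f'c].
have [j ij|i0] := unliftP 0 i.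
- rewrite -[LHS]/(\int[lebesgue_measure]_(s in `[0, 2 * pi])
    torus_int (fun y => 'D_(delta_mx 0 i) f (cons_rV s y))).
  have quot s y h : f (h *: delta_mx 0 i + cons_rV s y) =
      f (cons_rV s (h *: delta_mx 0 j + y)).
    congr f; apply/esym; apply: cons_rV_eq => [|k].
      by rewrite mxE cons_rV0 !mxE ij /= mulr0 add0r.
    by rewrite mxE cons_rVS !mxE ij (inj_eq lift_inj).
  have D_slice s y : 'D_(delta_mx 0 i) f (cons_rV s y) =
      'D_(delta_mx 0 j) (fun y => f (cons_rV s y)) y.
    by rewrite /derive /=; under eq_fun do rewrite quot.
  under eq_Rintegral => s _.
    rewrite (_ : (fun y => _) =
      'D_(delta_mx 0 j) (fun y => f (cons_rV s y))); last first.
      by apply/funext => y; rewrite D_slice.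
    rewrite IH; first over.
    + exact: cts_cons.
    (* A period of the slice is a period of f that fixes the first variable. *)
    + move=> y k.
      rewrite -(fp (cons_rV s y) (\row_l oapp (k 0) 0 (unlift 0 l))).
      congr f; apply: cons_rV_eq => [|l].
        by rewrite mxE cons_rV0 !mxE unlift_none /= mulr0 addr0.
      by rewrite mxE cons_rVS !mxE liftK.
    + move=> y; move: (fd (cons_rV s y)); rewrite /derivable /=.
      by under eq_fun do rewrite quot.
    + rewrite (_ : 'D__ _ = fun y => 'D_(delta_mx 0 i) f (cons_rV s y)).
        exact: (@cts_cons _ _ _ s f'c).
      by apply/funext => y; rewrite D_slice.
  by rewrite Rintegral_cst ?mul0r//; exact: measurable_itv.
pose df s := torus_int (fun y => 'D_(delta_mx 0 i) f (cons_rV s y)).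
pose F s := torus_int (fun y => f (cons_rV s y)).
have quot (s : R) (y : 'rV[R]_d) (h : R) :
    f (h *: delta_mx 0 i + cons_rV s y) =
    f (cons_rV (h *: 1 + s) y).
  congr f; apply/esym; apply: cons_rV_eq => [|k].
    by rewrite mxE cons_rV0 !mxE i0.
  by rewrite mxE cons_rVS !mxE i0 /= mulr0 add0r.
have dfd (s : R) (y : 'rV[R]_d) : is_derive s 1 (fun s => f (cons_rV s y))
    ('D_(delta_mx 0 i) f (cons_rV s y)).
  apply: is_derive_cvg; have := fd (cons_rV s y).
  rewrite /derivable /derive /=.
  rewrite (_ : (fun h : R => _) = fun h : R =>
    h^-1 *: (f (cons_rV (h *: 1 + s) y) - f (cons_rV s y))) //.
  by apply/funext => h; rewrite -quot.
have Fd (s : R) : is_derive s 1 F (df s).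
  apply: (@torus_int_leibniz d (fun y s => f (cons_rV s y))
    (fun y s => 'D_(delta_mx 0 i) f (cons_rV s y)) s 1 ltr01).
  - by move=> t _; exact: cts_cons.
  - move=> y; apply: (cts_comp f'c).
    by apply: cts_cons_rV; [exact: cts_snd|exact: cts_fst].
have pi20 : 0 < 2 * pi :> R by rewrite mulr_gt0// pi_gt0.
rewrite -[LHS]/(\int[lebesgue_measure]_(s in `[0, 2 * pi]) df s) /Rintegral.
rewrite (@continuous_FTC2 R df F 0 (2 * pi)) //=.
- rewrite (_ : F (2 * pi) = F 0) ?subrr//; congr torus_int; apply/funext => y.
  rewrite -(fp (cons_rV 0 y) (delta_mx 0 0)).
  congr f; apply: cons_rV_eq => [|l].
    by rewrite mxE cons_rV0 !mxE /= mulr1 add0r.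
  by rewrite mxE cons_rVS !mxE /= mulr0 addr0.
- by apply: continuous_subspaceT; exact: (@torus_int_slice_cts _ _ _ f'c).
- have Fc : continuous F by exact: torus_int_slice_cts.
  split=> [s _||]; first by have [] := Fd s.
    exact/cvg_at_right_filter/Fc.
  exact/cvg_at_left_filter/Fc.
- by move=> s _; rewrite derive1E; have [] := Fd s.
Qed.

End Leibniz.

(** * Fourier coefficients and differential operators *)

Section Fourier.
Context {R : realType}.

Lemma periodicz (f : R -> R) (c : R) : periodic f c ->
  forall (m : int) x, f (x + c * m%:~R) = f x.
Proof.
move=> fp [n|n] x; first by rewrite mulr_natr periodicn.
by rewrite NegzE mulrNz mulrN -(periodicn fp n.+1) -mulr_natr subrK.
Qed.

Section Phase.
Variables (d : nat) (zeta : 'rV[int]_d).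

Definition phase (x : 'rV[R]_d) : R := \sum_i (zeta 0 i)%:~R * x 0 i.

Lemma cts_phase : continuous phase.
Proof. by apply: cts_sum => i; apply: ctsZ; exact: coord_continuous. Qed.

Lemma phaseD x k :
  phase (x + (2 * pi) *: map_mx intr k) =
  phase x + pi *+ 2 * (\sum_i zeta 0 i * k 0 i)%:~R.
Proof.
rewrite /phase rmorph_sum /= mulr_sumr -big_split /=; apply: eq_bigr => i _.
by rewrite !mxE rmorphM /= -mulr_natl; ring.
Qed.

Lemma phase_delta x j (h : R) :
  phase (h *: delta_mx 0 j + x) = phase x + h * (zeta 0 j)%:~R.
Proof.
rewrite /phase (bigD1 j) //= [in RHS](bigD1 j) //= !mxE !eqxx /= mulr1.
rewrite (eq_bigr (fun i => (zeta 0 i)%:~R * x 0 i)); first by ring.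
by move=> i /negPf ij; rewrite !mxE ij mulr0 add0r.
Qed.

Lemma torus_periodic_phase (f : R -> R) :
  periodic f (pi *+ 2) -> torus_periodic (fun x => f (phase x)).
Proof. by move=> fp x k; rewrite phaseD periodicz. Qed.

(** Along the direction of the j-th coordinate, the phase is affine with slope
    zeta_j, so this is the chain rule in one real variable. *)
Lemma is_derive_phase (f : R -> R) f' x j : is_derive (phase x) 1 f f' ->
  is_derive x (delta_mx 0 j) (fun x => f (phase x)) ((zeta 0 j)%:~R * f').
Proof.
move=> fd; pose g (h : R) : R := phase x + h * (zeta 0 j)%:~R.
have gd : is_derive (0 : R) 1 g (zeta 0 j)%:~R.
  apply: is_derive_cvg; apply: cvg_near_cst; near=> h.
  rewrite [_ *: 1]mulr1 /g addr0 mul0r addr0 addrAC subrr add0r.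
  by rewrite -[LHS]/(_ * _) mulKf//; near: h; exact: nbhs_dnbhs_neq.
have g0 : g 0 = phase x by rewrite /g mul0r addr0.
have : is_derive (0 : R) 1 (f \o g) ((zeta 0 j)%:~R * f').
  have fd' : is_derive (g 0) 1 f f' by rewrite g0.
  by rewrite mulrC; exact: is_derive1_comp.
move=> -[fgd fgv]; apply: is_derive_cvg; rewrite -fgv.
have -> : (fun h : R =>
      h^-1 *: (f (phase (h *: delta_mx 0 j + x)) - f (phase x))) =
    (fun h => h^-1 *: ((f \o g) (h *: 1 + 0) - (f \o g) 0)).
  by apply/funext => h /=; rewrite g0 phase_delta /g addr0 [_ *: 1]mulr1.
exact: fgd.
Unshelve. all: by end_near. Qed.

Definition fcos (w : 'rV[R]_d -> R) := torus_int (fun x => cos (phase x) * w x).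
Definition fsin (w : 'rV[R]_d -> R) := torus_int (fun x => sin (phase x) * w x).

Lemma cts_cos_phase : continuous (fun x => cos (phase x)).
Proof. by apply: cts_comp; [exact: continuous_cos|exact: cts_phase]. Qed.

Lemma cts_sin_phase : continuous (fun x => sin (phase x)).
Proof. by apply: cts_comp; [exact: continuous_sin|exact: cts_phase]. Qed.

Section Ibp.
Variables (w : 'rV[R]_d -> R) (j : 'I_d).
Hypotheses (cw : continuous w) (pw : torus_periodic w)
  (dw : forall x, derivable w x (delta_mx 0 j))
  (cdw : continuous ('D_(delta_mx 0 j) w)).

(** Integration by parts without boundary term, by periodicity of
    f (phase x) * w x. *)
Lemma torus_int_ibp (f f' : R -> R) : periodic f (pi *+ 2) ->
  continuous f -> continuous f' -> (forall s : R, is_derive s 1 f (f' s)) ->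
  torus_int (fun x => f (phase x) * 'D_(delta_mx 0 j) w x) =
  - (zeta 0 j)%:~R * torus_int (fun x => f' (phase x) * w x).
Proof.
move=> fp fc f'c fd.
have fpc : continuous (fun x => f (phase x)).
  by apply: cts_comp => //; exact: cts_phase.
have f'pc : continuous (fun x => f' (phase x)).
  by apply: cts_comp => //; exact: cts_phase.
have D x : is_derive x (delta_mx 0 j) (fun x => f (phase x) * w x)
    (f (phase x) * 'D_(delta_mx 0 j) w x +
     (zeta 0 j)%:~R * (f' (phase x) * w x)).
  have dp := is_derive_phase j (fd (phase x)).
  have dw' : is_derive x (delta_mx 0 j) w ('D_(delta_mx 0 j) w x) by split.
  have := is_deriveM dp dw'.
  by rewrite [X in is_derive _ _ _ (_ + X)]mulrC -mulrA.
have DE : 'D_(delta_mx 0 j) (fun x => f (phase x) * w x) =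
    (fun x => f (phase x) * 'D_(delta_mx 0 j) w x +
     (zeta 0 j)%:~R * (f' (phase x) * w x)).
  by apply/funext => x; have [] := D x.
have c1 := ctsM fpc cdw.
have c2 := ctsM f'pc cw.
have c3 := ctsZ (c := (zeta 0 j)%:~R) c2.
have := @torus_int_derive R d (fun x => f (phase x) * w x) j.
rewrite DE torus_intD // torus_intZ // mulNr => H; apply/eqP.
rewrite -addr_eq0; apply/eqP; apply: H.
- exact: ctsM.
- by move=> x k; rewrite pw torus_periodic_phase.
- by move=> x; have [] := D x.
- exact: ctsD.
Qed.

Lemma fcos_derive : fcos ('D_(delta_mx 0 j) w) = (zeta 0 j)%:~R * fsin w.
Proof.
rewrite /fcos (@torus_int_ibp cos (fun s => - sin s)) //.
- have cs := ctsM cts_sin_phase cw.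
  rewrite mulNr -mulrN -torus_intN.
    by congr (_ * torus_int _); apply/funext => x; rewrite mulNr opprK.
  rewrite (_ : (fun x => _) = fun x => - (sin (phase x) * w x)).
    exact: ctsN.
  by apply/funext => x; rewrite mulNr.
- exact: cosD2pi.
- exact: continuous_cos.
- by apply: ctsN; exact: continuous_sin.
Qed.

Lemma fsin_derive : fsin ('D_(delta_mx 0 j) w) = - (zeta 0 j)%:~R * fcos w.
Proof.
rewrite /fsin (@torus_int_ibp sin cos) //.
- exact: sinD2pi.
- exact: continuous_sin.
- exact: continuous_cos.
Qed.

End Ibp.

(** The Fourier coefficient, up to normalisation, of a real function. *)
Definition fmode (w : 'rV[R]_d -> R) : R[i] := fcos w -i* fsin w.

Lemma mulcE (a b c e : R) :
  (a +i* b) * (c +i* e) = (a * c - b * e) +i* (a * e + b * c).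
Proof. by []. Qed.

(** The Fourier multiplier of the j-th partial derivative. *)
Definition ik j : R[i] := 0 +i* (zeta 0 j)%:~R.

Lemma fmode_derive w j : continuous w -> torus_periodic w ->
  (forall x, derivable w x (delta_mx 0 j)) ->
  continuous ('D_(delta_mx 0 j) w) ->
  fmode ('D_(delta_mx 0 j) w) = ik j * fmode w.
Proof.
move=> cw pw dw cdw; rewrite /fmode fcos_derive // fsin_derive // mulcE.
by congr (_ +i* _); ring.
Qed.

Lemma fmodeD (f g : 'rV[R]_d -> R) : continuous f -> continuous g ->
  fmode (fun x => f x + g x) = fmode f + fmode g.
Proof.
move=> cf cg; have cc := cts_cos_phase; have cs := cts_sin_phase.
rewrite /fmode /fcos /fsin -[RHS]/(_ +i* _) -opprD.
rewrite -!torus_intD; try exact: ctsM.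
by congr (_ +i* - _); congr torus_int; apply/funext => x; rewrite mulrDr.
Qed.

Lemma fmodeZ (c : R) (f : 'rV[R]_d -> R) : continuous f ->
  fmode (fun x => c * f x) = c%:C * fmode f.
Proof.
move=> cf; have cc := cts_cos_phase; have cs := cts_sin_phase.
rewrite /fmode /fcos /fsin mulcE !mul0r subr0 addr0 mulrN.
rewrite -!torus_intZ; try exact: ctsM.
by congr (_ +i* - _); congr torus_int; apply/funext => x; rewrite mulrCA.
Qed.

Lemma fmode0 : fmode (fun _ => 0) = 0.
Proof.
have H (g : 'rV[R]_d -> R) : torus_int (fun x => g x * 0) = 0.
  rewrite -[RHS](torus_int0 d); congr torus_int.
  by apply/funext => x; rewrite mulr0.
by rewrite /fmode /fcos /fsin !H oppr0.
Qed.

Lemma fmode_sum (I : Type) (r : seq I) (f : I -> 'rV[R]_d -> R) :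
  (forall i, continuous (f i)) ->
  fmode (fun x => \sum_(i <- r) f i x) = \sum_(i <- r) fmode (f i).
Proof.
move=> fc; elim: r => [|i r IH].
  by rewrite big_nil; under eq_fun do rewrite big_nil; rewrite fmode0.
rewrite big_cons; under eq_fun do rewrite big_cons.
by rewrite fmodeD // ?IH//; exact: cts_sum.
Qed.

Lemma torus_periodic_derive (w : 'rV[R]_d -> R) v :
  torus_periodic w -> torus_periodic ('D_v w).
Proof.
move=> pw x k; rewrite /derive.
rewrite (_ : (fun h : R => _) = (fun h => h^-1 *: (w (h *: v + x) - w x)))//.
by apply/funext => h /=; rewrite addrA !pw.
Qed.

Lemma torus_periodic_pderiv (w : 'rV[R]_d -> R) s :
  torus_periodic w -> torus_periodic (pderiv s w).
Proof. by move=> pw; elim: s => //= i s IH; exact: torus_periodic_derive. Qed.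

Lemma fmode_pderiv n w s : torus_periodic w ->
  (forall (s : seq 'I_d) i x, (size s < n)%N ->
    derivable (pderiv s w) x (delta_mx 0 i)) ->
  (forall s : seq 'I_d, (size s <= n)%N -> continuous (pderiv s w)) ->
  (size s <= n)%N ->
  fmode (pderiv s w) = (\prod_(i <- s) ik i) * fmode w.
Proof.
move=> pw dw cw; elim: s => [|i s IH] sn; first by rewrite big_nil mul1r.
have sn' : (size s <= n)%N by exact: ltnW.
rewrite big_cons -mulrA -IH // -fmode_derive //.
- exact: cw.
- exact: torus_periodic_pderiv.
- by move=> x; exact: dw.
- exact: (cw (i :: s)).
Qed.

(** The symbol of the operator, evaluated at the frequency zeta. *)
Definition symbol n (p : coefs R d n) : R[i] :=
  \sum_(a : mpoly.bmultinom d n.+1) (p a)%:C * \prod_(i <- mnm_seq a) ik i.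

Lemma size_mnm_seq (a : mpoly.multinom d) : size (mnm_seq a) = mpoly.mdeg a.
Proof.
rewrite /mnm_seq size_flatten /shape -map_comp mpoly.mdegE sumnE big_map.
by rewrite -[RHS]big_enum /=; apply: eq_bigr => i _; rewrite size_nseq.
Qed.

Lemma size_bmnm n (a : mpoly.bmultinom d n.+1) : (size (mnm_seq a) <= n)%N.
Proof. by rewrite size_mnm_seq -ltnS mpoly.bmdeg. Qed.

Lemma fmode_diffop n w (p : coefs R d n) : torus_periodic w ->
  (forall (s : seq 'I_d) i x, (size s < n)%N ->
    derivable (pderiv s w) x (delta_mx 0 i)) ->
  (forall s : seq 'I_d, (size s <= n)%N -> continuous (pderiv s w)) ->
  fmode (diffop p w) = symbol p * fmode w.
Proof.
move=> pw dw cw; rewrite /diffop /symbol mulr_suml.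
have cpd (a : mpoly.bmultinom d n.+1) : continuous (pderiv (mnm_seq a) w).
  by apply: cw; exact: size_bmnm.
rewrite fmode_sum; last by move=> a; exact: ctsZ.
apply: eq_bigr => a _; rewrite fmodeZ // -mulrA (@fmode_pderiv n) //.
exact: size_bmnm.
Qed.

End Phase.
End Fourier.

(** * Evolution of the Fourier coefficients of a solution *)

Section Evolution.
Context {R : realType}.

Lemma is_derive_lin (a t : R) : is_derive t 1 (fun s => a * s) a.
Proof.
apply: is_derive_cvg; apply: cvg_near_cst; near=> h.
rewrite [_ *: 1]mulr1 mulrDr addrK -[LHS]/(_ * _) mulrCA mulVf ?mulr1//.
by near: h; exact: nbhs_dnbhs_neq.
Unshelve. all: by end_near. Qed.

Lemma is_derive_comp_lin (f : R -> R) f' (a t : R) :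
  is_derive (a * t) 1 f f' -> is_derive t 1 (fun s => f (a * s)) (a * f').
Proof.
by move=> fd; rewrite mulrC; apply: (is_derive1_comp fd (is_derive_lin a t)).
Qed.

(** The real form of the equation K' = - (a + i b) K for K = X + i Y: the
    components of exp((a + i b) t) K(t) have zero derivative. *)
Lemma ode_rotation (a b T : R) (X Y : R -> R) :
  continuous X -> continuous Y ->
  (forall t : R, 0 < t < T -> is_derive t 1 X (- (a * X t - b * Y t))) ->
  (forall t : R, 0 < t < T -> is_derive t 1 Y (- (a * Y t + b * X t))) ->
  forall t : R, 0 <= t <= T ->
    expR (a * t) * (cos (b * t) * X t - sin (b * t) * Y t) = X 0 /\
    expR (a * t) * (cos (b * t) * Y t + sin (b * t) * X t) = Y 0.
Proof.
move=> cX cY dX dY t /andP[t0 tT].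
have cl (g : R -> R) (c : R) : continuous g -> continuous (fun s => g (c * s)).
  by move=> cg; apply: (cts_comp cg); apply: ctsZ; exact: cts_id.
have cE : continuous (fun s => expR (a * s)).
  by apply: cl; exact: continuous_expR.
have cC : continuous (fun s => cos (b * s)) by apply: cl; exact: continuous_cos.
have cS : continuous (fun s => sin (b * s)) by apply: cl; exact: continuous_sin.
have cst (g : R -> R) : continuous g ->
    (forall s : R, 0 < s < T -> is_derive s 1 g 0) -> g t = g 0.
  move=> cg dg; have [||c _ /eqP] := @MVT_segment R g (fun=> 0) 0 t t0.
  - move=> s; rewrite in_itv /= => /andP[s0 st]; apply: dg.
    by rewrite s0 (lt_le_trans st).
  - exact: continuous_subspaceT.
  - by rewrite mul0r subr_eq0 => /eqP.
(* F and G are the real and imaginary parts of exp((a + i b) s) K(s). *)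
pose F s := expR (a * s) * (cos (b * s) * X s - sin (b * s) * Y s).
pose G s := expR (a * s) * (cos (b * s) * Y s + sin (b * s) * X s).
have cF : continuous F by apply: ctsM => //; apply: ctsB; exact: ctsM.
have cG : continuous G by apply: ctsM => //; apply: ctsD; exact: ctsM.
have dF s : 0 < s < T -> is_derive s 1 F 0.
  move=> sT.
  have dE := is_derive_comp_lin (is_derive_expR (a * s)).
  have dC := is_derive_comp_lin (is_derive_cos (b * s)).
  have dS := is_derive_comp_lin (is_derive_sin (b * s)).
  have := is_deriveM dE (is_deriveB (is_deriveM dC (dX s sT))
    (is_deriveM dS (dY s sT))).
  move/is_derive_eq; apply; rewrite /GRing.scale /=.
  rewrite -[V in _ + V * (a * expR _)]/(cos (b * s) * X s - sin (b * s) * Y s).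
  ring.
have dG s : 0 < s < T -> is_derive s 1 G 0.
  move=> sT.
  have dE := is_derive_comp_lin (is_derive_expR (a * s)).
  have dC := is_derive_comp_lin (is_derive_cos (b * s)).
  have dS := is_derive_comp_lin (is_derive_sin (b * s)).
  have := is_deriveM dE (is_deriveD (is_deriveM dC (dY s sT))
    (is_deriveM dS (dX s sT))).
  move/is_derive_eq; apply; rewrite /GRing.scale /=.
  rewrite -[V in _ + V * (a * expR _)]/(cos (b * s) * Y s + sin (b * s) * X s).
  ring.
split; [rewrite -[LHS]/(F t) (cst F cF dF)|rewrite -[LHS]/(G t) (cst G cG dG)].
  by rewrite /F !mulr0 expR0 cos0 sin0 !mul1r mul0r subr0.
by rewrite /G !mulr0 expR0 cos0 sin0 !mul1r mul0r addr0.
Qed.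

Section Solution.
Variables (d n : nat) (p : coefs R d n) (T : R) (w : 'rV[R]_d -> R -> R).
Hypotheses (T0 : 0 < T)
  (pw : forall t : R, 0 <= t <= T -> torus_periodic (w ^~ t))
  (sw : classical_solution p T w).

(* Extends the solution beyond [0, T] by its boundary values, which gives a
   function continuous on the whole space and unchanged on [0, T]. *)
Let clamp (t : R) := Num.min (Num.max t 0) T.

Let clampP t : 0 <= clamp t <= T.
Proof. by rewrite le_min le_max lexx orbT (ltW T0) /= ge_min lexx orbT. Qed.

Let clamp_id t : 0 <= t <= T -> clamp t = t.
Proof. by move=> /andP[t0 tT]; rewrite /clamp max_l // min_l. Qed.

Let cts_clamp : continuous clamp.
Proof.
apply: min_fun_continuous; last exact: cts_cst.
by apply: max_fun_continuous; [exact: cts_id|exact: cts_cst].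
Qed.

Let W x t := w x (clamp t).

Let cts_W : continuous (fun z => W z.1 z.2).
Proof.
case: sw => cw _ _ _.
apply: (@cts_within_comp _ _ _ _ (fun z => w z.1 z.2)
  (fun z => (z.1, clamp z.2)) cw).
  apply: cts_pair; first exact: cts_fst.
  by apply: (cts_comp cts_clamp); exact: cts_snd.
by move=> z; exact: clampP.
Qed.

Let cts_pd t (s : seq 'I_d) : 0 < t < T -> (size s <= n)%N ->
  forall x, {for (x, t), continuous (fun z => pderiv s (w ^~ z.2) z.1)}.
Proof.
move=> tT sn x; case: sw => _ _ cw _.
apply: (cts_within_open (cw s sn)) => //.
rewrite (_ : [set _ | _] = snd @^-1` `]0, T[%classic).
  by apply: open_comp => [z _|]; [exact: cvg_snd|exact: interval_open].
by apply/seteqP; split => z /=; rewrite in_itv.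
Qed.

Let cts_diffop t : 0 < t < T ->
  forall x, {for (x, t), continuous (fun z => diffop p (w ^~ z.2) z.1)}.
Proof.
move=> tT x; apply: cts_at_sum => a.
apply: (@continuousM _ _ (fun=> p a)); first exact: cst_continuous.
by apply: cts_pd => //; exact: size_bmnm.
Qed.

Let torus_int_W_derive (e : 'rV[R]_d -> R) t : continuous e -> 0 < t < T ->
  is_derive t 1 (fun t => torus_int (fun x => e x * W x t))
    (- torus_int (fun x => e x * diffop p (w ^~ t) x)).
Proof.
move=> ce /andP[t0 tT].
have ceN : continuous (fun x => e x * diffop p (w ^~ t) x).
  apply: ctsM => //; apply: (cts_slice (g := fun x t => diffop p (w ^~ t) x)).
  by apply: cts_diffop; rewrite t0.
have -> : - torus_int (fun x => e x * diffop p (w ^~ t) x) =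
    torus_int (fun x => e x * - diffop p (w ^~ t) x).
  by rewrite -torus_intN //; congr torus_int; apply/funext => x; rewrite mulrN.
have r0 : 0 < Num.min t (T - t) by rewrite lt_min t0 subr_gt0.
have near_t s : `|s - t| < Num.min t (T - t) -> 0 < s < T.
  by rewrite lt_min !ltr_norml => /andP[/andP[? ?] /andP[? ?]]; lra.
apply: (torus_int_leibniz (f := fun x t => e x * W x t)
  (f' := fun x t => e x * - diffop p (w ^~ t) x) r0).
- move=> x s /near_t sT; case: sw => _ _ _ /(_ x s sT) dw.
  have dW : is_derive s 1 (W x) (- diffop p (w ^~ s) x).
    apply: near_eq_is_derive dw.
    have : \forall y \near s, y \in `]0, T[ by exact: near_in_itvoo.
    apply: filterS => y; rewrite in_itv /= /W => /andP[y0 yT].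
    by rewrite clamp_id // !ltW.
  have := is_deriveM (is_derive_cst (e x) s 1) dW.
  by move/is_derive_eq; apply; rewrite scaler0 addr0.
- move=> s _; apply: ctsM => //; apply: (cts_slice (g := W)) => x; exact: cts_W.
- move=> x.
  apply: (@continuousM _ _ (fun z => e z.1)).
    by apply: continuous_comp; [exact: cvg_fst|exact: ce].
  by apply: continuousN; apply: cts_diffop; rewrite t0.
Qed.

Let cts_torus_int_W (e : 'rV[R]_d -> R) : continuous e ->
  continuous (fun t => torus_int (fun x => e x * W x t)).
Proof.
move=> ce; apply: (torus_int_cts (h := fun x t => e x * W x t)).
by apply: ctsM cts_W; apply: (cts_comp ce); exact: cts_fst.
Qed.

Lemma fmode_evolution zeta t : 0 <= t <= T ->
  (expR (complex.Re (symbol zeta p) * t))%:C *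
    expi (complex.Im (symbol zeta p) * t) * fmode zeta (w ^~ t) =
  fmode zeta (w ^~ 0).
Proof.
move=> tT; pose X t := fcos zeta (W ^~ t); pose Y t := - fsin zeta (W ^~ t).
set a := complex.Re _; set b := complex.Im _.
have WE s : 0 <= s <= T -> fmode zeta (w ^~ s) = X s +i* Y s.
  by move=> sT; rewrite /X /Y /W clamp_id.
have cX : continuous X by apply: cts_torus_int_W; exact: cts_cos_phase.
have cY : continuous Y.
  by apply: ctsN; apply: cts_torus_int_W; exact: cts_sin_phase.
have dif s : 0 < s < T -> fmode zeta (diffop p (w ^~ s)) =
    (a * X s - b * Y s) +i* (a * Y s + b * X s).
  move=> /[dup] sT /andP[s0 sT1]; have sT' : 0 <= s <= T by rewrite !ltW.
  case: (sw) => _ dw _ _.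
  rewrite (@fmode_diffop _ _ zeta n) //; last first.
  - move=> q qn; apply: (cts_slice (g := fun x t => pderiv q (w ^~ t) x)).
    exact: cts_pd.
  - by move=> q i x qn; exact: dw.
  - exact: pw.
  rewrite WE // [symbol _ _](_ : _ = a +i* b) ?mulcE //.
  by rewrite /a /b; case: (symbol _ _).
have [||] := @ode_rotation a b T X Y cX cY _ _ t tT.
- move=> s sT; have [<- _] := dif s sT.
  exact: (@torus_int_W_derive (fun x => cos (phase zeta x)) s
    (@cts_cos_phase _ _ zeta) sT).
- move=> s sT; have [_ <-] := dif s sT; apply: is_deriveN.
  exact: (@torus_int_W_derive (fun x => sin (phase zeta x)) s
    (@cts_sin_phase _ _ zeta) sT).
- have z0 : 0 <= (0 : R) <= T by apply/andP; split; [exact: lexx|exact: ltW].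
  move=> e1 e2; rewrite (WE t tT) (WE 0 z0) -e1 -e2.
  rewrite /expi !mulcE.
  by congr (_ +i* _); ring.
Qed.
End Solution.
End Evolution.

Section FourierSolution.
Context {R : realType}.

Lemma cos_eq1 (x : R) : cos x = 1 -> `|x| < 2 * pi -> x = 0.
Proof.
move=> cx xpi; apply/eqP/negPn/negP => x0.
(* As cos x = 1 - 2 sin (x / 2) ^ 2, it is enough that this sine is nonzero. *)
have : 0 < sin (`|x| / 2).
  by apply: sin_gt0_pi; rewrite divr_gt0 ?normr_gt0 //= ltr_pdivrMr // mulrC.
have : sin (`|x| / 2) ^+ 2 = 0.
  apply/eqP; move: cx; rewrite -cos_norm [X in cos X](splitr `|x|) cosD.
  rewrite -!expr2 cos2sin2 => cx; apply/eqP; lra.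
by move/eqP; rewrite sqrf_eq0 => /eqP ->; rewrite ltxx.
Qed.

Lemma fourierE d (f : 'rV[R]_d -> R[i]) zeta :
  continuous (fun x => complex.Re (f x)) ->
  continuous (fun x => complex.Im (f x)) ->
  fourier f zeta = ((2 * pi) `^ (- (d%:R / 2)))%:C *
   (fmode zeta (fun x => complex.Re (f x)) +
    (0 +i* 1) * fmode zeta (fun x => complex.Im (f x))).
Proof.
move=> cr ci; rewrite /fourier; congr (_ * _).
have cc := @cts_cos_phase R d zeta; have cs := @cts_sin_phase R d zeta.
rewrite /fmode mulcE !mul0r !mul1r !add0r opprK.
rewrite -[RHS]/(_ +i* _) /torus_intC; congr (_ +i* _).
  rewrite /fcos /fsin -torus_intD; try exact: ctsM.
  congr torus_int; apply/funext => x; rewrite /expi.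
  case: (f x) => r i.
  by rewrite mulcE /= cosN sinN -/(phase zeta x) mulNr opprK.
rewrite /fcos /fsin addrC -torus_intB; try exact: ctsM.
congr torus_int; apply/funext => x; rewrite /expi.
by case: (f x) => r i; rewrite mulcE /= cosN sinN -/(phase zeta x) mulNr.
Qed.

(** This is exp(s t) for complex s and real t. *)
Definition propagator (s : R[i]) (t : R) : R[i] :=
  (expR (complex.Re s * t))%:C * expi (complex.Im s * t).

Lemma cts_solution d n (p : coefs R d n) (T t : R) (w : 'rV[R]_d -> R -> R) :
  classical_solution p T w -> 0 <= t <= T -> continuous (w ^~ t).
Proof.
move=> [cw _ _ _] tT.
apply: (cts_within_comp (f := fun z => w z.1 z.2)
  (g := fun x => (x, t)) cw) => //.
by apply: cts_pair; [exact: cts_id|exact: cts_cst].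
Qed.

Lemma fourier_evolution d n (p : coefs R d n) (T t : R)
    (u : 'rV[R]_d -> R -> R[i]) zeta :
  0 < T -> solves p T u -> 0 <= t <= T ->
  propagator (symbol zeta p) t * fourier (u ^~ t) zeta = fourier (u ^~ 0) zeta.
Proof.
move=> T0 [pu sr si] tT.
have z0 : 0 <= (0 : R) <= T by apply/andP; split; [exact: lexx|exact: ltW].
have [cr ci] := (cts_solution sr tT, cts_solution si tT).
have [cr0 ci0] := (cts_solution sr z0, cts_solution si z0).
rewrite !fourierE // /propagator mulrCA; congr (_ * _).
rewrite mulrDr mulrCA (fmode_evolution T0 _ sr) //.
  rewrite (fmode_evolution T0 _ si) //.
  by move=> s /pu pus x k; rewrite pus.
by move=> s /pu pus x k; rewrite pus.
Qed.

Lemma propagatorD s s' t t' :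
  propagator s t * propagator s' t' =
  (expR (complex.Re s * t + complex.Re s' * t'))%:C *
    expi (complex.Im s * t + complex.Im s' * t').
Proof.
rewrite /propagator mulrACA expRD rmorphM /=; congr (_ * _).
by rewrite /expi mulcE cosD sinD; congr (_ +i* _); rewrite addrC.
Qed.

Lemma exp_expi_inj (a a' b b' : R) :
  (expR a)%:C * expi b = (expR a')%:C * expi b' -> a = a' /\ cos (b - b') = 1.
Proof.
rewrite /expi !mulcE !mul0r !subr0 !addr0 => -[e1 e2].
have E (x y : R) : (expR x * cos y) ^+ 2 + (expR x * sin y) ^+ 2 = expR x ^+ 2.
  by rewrite !exprMn -mulrDr cos2Dsin2 mulr1.
have ee : expR a = expR a'.
  have := E a b; rewrite e1 e2 E => /eqP.
  by rewrite eqrXn2 ?expR_ge0 // => /eqP.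
split; first by exact: expR_inj.
move: e1 e2; rewrite ee.
have ne : expR a' != 0 by rewrite gt_eqF ?expR_gt0.
by move=> /(mulfI ne) e1 /(mulfI ne) e2; rewrite cosB e1 e2 -!expr2 cos2Dsin2.
Qed.

(** Cross-multiplying cancels the initial values and gives
    exp(s t1 + s' t2) = exp(s' t1 + s t2). The moduli give the real parts; the
    arguments give the imaginary parts, up to a multiple of 2 pi. *)
Lemma symbols_eq (s s' : R[i]) (t1 t2 : R) (f0 g0 f1 f2 : R[i]) :
  f0 != 0 -> t1 != t2 ->
  propagator s t1 * f1 = f0 -> propagator s t2 * f2 = f0 ->
  propagator s' t1 * f1 = g0 -> propagator s' t2 * f2 = g0 ->
  complex.Re s = complex.Re s' /\
  (`|(complex.Im s - complex.Im s') * (t2 - t1)| < 2 * pi ->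
   complex.Im s = complex.Im s').
Proof.
move=> f00 t12 e1 e2 e1' e2'.
have f10 : f1 != 0 by apply: contra_neq f00 => f1E; rewrite -e1 f1E mulr0.
have f20 : f2 != 0 by apply: contra_neq f00 => f2E; rewrite -e2 f2E mulr0.
have : propagator s t1 * propagator s' t2 = propagator s' t1 * propagator s t2.
  apply: (mulIf (mulf_neq0 f10 f20)).
  by rewrite mulrACA e1 e2' mulrACA e1' e2 mulrC.
rewrite !propagatorD => /exp_expi_inj[er ei].
have t0 : t2 - t1 != 0 by rewrite subr_eq0 eq_sym.
split.
  by apply/eqP; rewrite -subr_eq0 -(inj_eq (mulIf t0)) mul0r; apply/eqP; lra.
move=> small; apply/eqP; rewrite -subr_eq0 -(inj_eq (mulIf t0)) mul0r.
apply/eqP; apply: cos_eq1 => //; rewrite -cosN -ei; congr cos; ring.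
Qed.

End FourierSolution.

(** * Determination of the coefficients from the symbol *)

Section FiniteTest.

(** The vectors (phi z a)_a for z in Q lie in a finite-dimensional space, so
    they are spanned by finitely many of them: enlarge s until the dimension of
    the span stops growing. A linear form c that vanishes on the latter vanishes
    on all of them. *)
Lemma finite_test (K : fieldType) (A : finType) (Z : eqType) (phi : Z -> A -> K)
    (Q : set Z) :
  exists2 s : seq Z, (forall z, z \in s -> Q z) &
  forall c : A -> K, (forall z, z \in s -> \sum_a c a * phi z a = 0) ->
    forall z, Q z -> \sum_a c a * phi z a = 0.
Proof.
pose row z : {ffun A -> K^o} := [ffun a => phi z a].
pose V s := <<map row s>>%VS.
have [s sQ sV] : exists2 s : seq Z, (forall z, z \in s -> Q z) &
    forall z, Q z -> row z \in V s.
  have [m] := ubnP (\dim {: {ffun A -> K^o}} - \dim (V [::]))%N.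
  have : forall z, z \in [::] -> Q z by [].
  elim: m [::] => [//|m IH] s sQ; rewrite ltnS => dm.
  have [sV|/existsNP[z /not_implyP[Qz zV]]] :=
    pselect (forall z, Q z -> row z \in V s); first by exists s.
  apply: (IH (z :: s)).
    by move=> y; rewrite inE => /predU1P[->|/sQ].
  apply: leq_trans dm.
  have lt : (\dim (V s) < \dim (V (z :: s)))%N.
    rewrite ltn_neqAle; apply/andP; split; last first.
      by apply: dimvS; rewrite /V /= span_cons addvSr.
    apply/negP => /eqP dE; apply: zV.
    have /eqP -> : V s == V (z :: s).
      by rewrite eqEdim dE leqnn andbT /V /= span_cons addvSr.
    by apply: memv_span; rewrite inE eqxx.
  exact: ltn_sub2l (leq_trans lt (dimvS (subvf (V (z :: s))))) lt.
exists s => // c cs z /sV zV.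
have H : forall v : {ffun A -> K^o}, v \in V s -> \sum_a c a * v a = 0.
  move=> v vV; rewrite (@coord_span _ _ _ (in_tuple (map row s)) _ vV).
  under eq_bigr do rewrite sum_ffunE mulr_sumr.
  rewrite exchange_big big1 // => i _ /=.
  have /mapP[y ys ->] := mem_nth 0 (ltn_ord i).
  under eq_bigr do rewrite !ffunE mulrCA.
  by rewrite -mulr_sumr cs // mulr0.
by rewrite -[RHS](H _ zV); apply: eq_bigr => a _; rewrite ffunE.
Qed.

End FiniteTest.

Section Symbol.
Context {R : realType}.

Definition monom d (zeta : 'rV[int]_d) (a : mpoly.multinom d) : R :=
  \prod_i (zeta 0 i)%:~R ^+ a i.

Lemma prod_ik d (zeta : 'rV[int]_d) (a : mpoly.multinom d) :
  \prod_(i <- mnm_seq a) ik zeta i =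
  'i%C ^+ mpoly.mdeg a * (monom zeta a)%:C :> R[i].
Proof.
rewrite /mnm_seq big_flatten big_map big_enum /=.
rewrite mpoly.mdegE expr_sum /monom rmorph_prod -big_split /=.
apply: eq_bigr => i _; rewrite big_nseq iter_mulr_1 rmorphXn -exprMn.
by congr (_ ^+ _); rewrite mulcE !mul0r !mul1r subr0 add0r.
Qed.

(** The powers of i are real or purely imaginary according to the parity of the
    exponent: this is what separates the even and odd parts of the symbol. *)
Lemma expr_i m : 'i%C ^+ m =
  (if odd m then 0 +i* (-1) ^+ m./2 else (-1) ^+ m./2 +i* 0) :> R[i].
Proof.
have E k : ('i%C : R[i]) ^+ k.*2 = ((-1) ^+ k)%:C.
  by rewrite -mul2n exprM sqr_i rmorphXn rmorphN1.
rewrite -[in LHS](odd_double_half m) exprD E; case: (odd m) => /=.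
  by rewrite expr1 mulcE !mul0r !mul1r subr0 add0r.
by rewrite expr0 mul1r.
Qed.

Lemma Re_symbol d n (p : coefs R d n) zeta : complex.Re (symbol zeta p) =
  \sum_a p a * (complex.Re ('i%C ^+ mpoly.mdeg a) * monom zeta a).
Proof.
rewrite /symbol; elim/big_rec2: _ => [//|a x y _ <-]; case: y => yr yi.
by rewrite prod_ik; case: ('i%C ^+ _) => r i; rewrite !mulcE /=; ring.
Qed.

Lemma Im_symbol d n (p : coefs R d n) zeta : complex.Im (symbol zeta p) =
  \sum_a p a * (complex.Im ('i%C ^+ mpoly.mdeg a) * monom zeta a).
Proof.
rewrite /symbol; elim/big_rec2: _ => [//|a x y _ <-]; case: y => yr yi.
by rewrite prod_ik; case: ('i%C ^+ _) => r i; rewrite !mulcE /=; ring.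
Qed.

(** If some coefficient were nonzero, the polynomial with these coefficients
    would be a parity hypersurface containing Q. *)
Lemma parity_coef0 d n (Q : set 'rV[int]_d) (b : bool)
    (c : mpoly.bmultinom d n.+1 -> R) :
  ~ on_parity_hypersurface R n Q ->
  (forall a : mpoly.bmultinom d n.+1, odd (mpoly.mdeg a) != b -> c a = 0) ->
  (forall zeta, Q zeta -> \sum_a c a * monom zeta a = 0) ->
  forall a, c a = 0.
Proof.
move=> nQ cb cQ a; apply/eqP/negPn/negP => ca; apply: nQ.
pose P : mpoly.mpoly d R :=
  \sum_(a : mpoly.bmultinom d n.+1) c a *: mpoly.mpolyX R a.
have PE m : mpoly.mcoeff m P =
    \sum_(a : mpoly.bmultinom d n.+1) c a * ((a : mpoly.multinom d) == m)%:R.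
  rewrite raddf_sum; apply: eq_bigr => a' _.
  by rewrite /= mpoly.mcoeffZ mpoly.mcoeffX.
have Pm m : m \in mpoly.msupp P -> exists2 a', c a' != 0 & m = mpoly.bmnm a'.
  rewrite mpoly.mcoeff_msupp PE => s0.
  have [a' ca'|none] := pickP (fun a' => (c a' != 0) && (mpoly.bmnm a' == m)).
    by exists a'; case/andP: ca' => // _ /eqP.
  case/eqP: s0; apply: big1 => a' _; move: (none a') => /negbT.
  rewrite negb_and negbK => /orP[/eqP ->|/negPf ->]; first by rewrite mul0r.
  by rewrite mulr0.
have Pa : mpoly.mcoeff a P = c a.
  rewrite PE (bigD1 a) //= eqxx mulr1 big1 ?addr0 // => a' a'a.
  rewrite -[_ == _]/(mpoly.bmnm a' == mpoly.bmnm a) (inj_eq val_inj).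
  by rewrite (negPf a'a) mulr0.
have Podd m : m \in mpoly.msupp P -> odd (mpoly.mdeg m) = b.
  by move=> /Pm[a' ca' ->]; apply/eqP; apply: contraNT ca' => /cb ->.
exists P; split.
- by apply: contra_neq ca => P0; rewrite -Pa P0 mpoly.mcoeff0.
- by move=> m /Pm[a' _ ->]; rewrite -ltnS mpoly.bmdeg.
- by case: (b) Podd => Podd; [right|left] => m /Podd ->.
- move=> zeta /cQ <-; rewrite raddf_sum; apply: eq_bigr => a' _.
  by rewrite /= mpoly.mevalZ mpoly.mevalX.
Qed.

End Symbol.

Theorem theorem3p2 (R : realType) (d n : nat) (d_gt0 : (0 < d)%N)
    (T : R) (T_gt0 : 0 < T) (u0 : 'rV[R]_d -> R[i]) (Q : set 'rV[int]_d)
    (* uphalf n = floor ((n - 1) / 2) + 1, also for n = 0 *)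
    (Q_def : Q = [set zeta : 'rV[int]_d | fourier u0 zeta != 0])
    (Q_card : `I_(maxn (\sum_(0 <= k < (n./2).+1) 'C(2 * k + d - 1, d - 1))
                       (\sum_(0 <= k < uphalf n) 'C(2 * k + d, d - 1)))%N
              #<= Q)
    (Q_gen : ~ on_parity_hypersurface R n Q) :
  forall M : R, exists2 delta : R, 0 < delta &
    forall p q : coefs R d n,
      (forall a, `|p a| <= M) -> (forall a, `|q a| <= M) ->
    forall u v : 'rV[R]_d -> R -> R[i],
      solves p T u -> (forall x, u x 0 = u0 x) ->
      solves q T v ->
    forall t1 t2 : R,
      0 <= t1 <= T -> 0 <= t2 <= T -> 0 < `|t2 - t1| < delta ->
      (forall x, u x t1 = v x t1) -> (forall x, u x t2 = v x t2) ->
    p = q.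
Proof.
move=> M.
have [s sQ sE] := @finite_test R (mpoly.bmultinom d n.+1) 'rV[int]_d
  (fun zeta a => monom zeta a) Q.
(* B bounds the difference of the two symbols on s; the constant 1 below
   avoids a division by zero. *)
pose B : R := \sum_(zeta <- s) \sum_(a : mpoly.bmultinom d n.+1)
  2 * `|M| * `|monom zeta a|.
have B0 : 0 <= B.
  by apply: sumr_ge0 => zeta _; apply: sumr_ge0 => a _; rewrite !mulr_ge0.
have pi20 : 0 < 2 * pi :> R by rewrite mulr_gt0// pi_gt0.
exists (2 * pi / (B + 1)); first by rewrite divr_gt0 // ltr_wpDl.
move=> p q pM qM u v su u00 sv t1 t2 t1T t2T /andP[t12 t12d] uv1 uv2.
have t12' : t1 != t2 by rewrite eq_sym -subr_eq0 -normr_gt0.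
have u0E : u ^~ 0 = u0 by apply/funext => x; exact: u00.
have uE1 : v ^~ t1 = u ^~ t1 by apply/funext => x; rewrite uv1.
have uE2 : v ^~ t2 = u ^~ t2 by apply/funext => x; rewrite uv2.
have symE zeta : Q zeta ->
    complex.Re (symbol zeta p) = complex.Re (symbol zeta q) /\
    (`|(complex.Im (symbol zeta p) - complex.Im (symbol zeta q)) * (t2 - t1)|
       < 2 * pi ->
     complex.Im (symbol zeta p) = complex.Im (symbol zeta q)).
  rewrite Q_def /= -u0E => f0.
  apply: (symbols_eq f0 t12' (fourier_evolution zeta T_gt0 su t1T)
    (fourier_evolution zeta T_gt0 su t2T) (g0 := fourier (v ^~ 0) zeta)).
    by rewrite -uE1; exact: (fourier_evolution zeta T_gt0 sv t1T).
  by rewrite -uE2; exact: (fourier_evolution zeta T_gt0 sv t2T).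
(* The coefficients of the real and imaginary parts of the difference of the
   symbols: the former vanish for |a| odd, the latter for |a| even. *)
pose ce (a : mpoly.bmultinom d n.+1) : R :=
  (p a - q a) * complex.Re ('i%C ^+ mpoly.mdeg a).
pose co (a : mpoly.bmultinom d n.+1) : R :=
  (p a - q a) * complex.Im ('i%C ^+ mpoly.mdeg a).
have ReE zeta : complex.Re (symbol zeta p) - complex.Re (symbol zeta q) =
    \sum_a ce a * monom zeta a.
  by rewrite !Re_symbol -sumrB; apply: eq_bigr => a _; rewrite /ce; ring.
have ImE zeta : complex.Im (symbol zeta p) - complex.Im (symbol zeta q) =
    \sum_a co a * monom zeta a.
  by rewrite !Im_symbol -sumrB; apply: eq_bigr => a _; rewrite /co; ring.
have ce0 : forall a, ce a = 0.
  apply: (parity_coef0 (b := false) Q_gen) => [a|zeta Qz]; last first.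
    by have [e _] := symE zeta Qz; rewrite -ReE e subrr.
  by rewrite /ce expr_i; case: (odd _) => //=; rewrite mulr0.
have co0 : forall a, co a = 0.
  apply: (parity_coef0 (b := true) Q_gen) => [a|].
    by rewrite /co expr_i; case: (odd _) => //=; rewrite mulr0.
  apply: (sE co) => zeta zs; rewrite -ImE.
  apply/eqP; rewrite subr_eq0; apply/eqP.
  apply: (proj2 (symE zeta (sQ zeta zs))); rewrite ImE normrM.
  have bound : `|\sum_a co a * monom zeta a| <= B.
    apply: (@le_trans _ _ (\sum_(a : mpoly.bmultinom d n.+1)
      2 * `|M| * `|monom zeta a : R|)).
      apply: (le_trans (ler_norm_sum _ _ _)); apply: ler_sum => a _.
      rewrite normrM ler_wpM2r // /co normrM.
      have i1 : `|complex.Im ('i%C ^+ mpoly.mdeg a : R[i])| <= 1.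
        rewrite expr_i; case: (odd _) => /=; rewrite ?normr0 //.
        by rewrite normrX normrN1 expr1n.
      rewrite -[leRHS]mulr1 ler_pM //.
      rewrite mulr_natl mulr2n (le_trans (ler_normB _ _)) // lerD //.
        by rewrite (le_trans (pM a)) // ler_norm.
      by rewrite (le_trans (qM a)) // ler_norm.
    rewrite /B (big_rem zeta) //= lerDl; apply: sumr_ge0 => z _.
    by apply: sumr_ge0 => a _; rewrite !mulr_ge0.
  have B1 : 0 < B + 1 by rewrite ltr_wpDl.
  apply: (@le_lt_trans _ _ ((B + 1) * `|t2 - t1|)).
    by rewrite ler_wpM2r // (le_trans bound) // lerDl.
  by rewrite mulrC -ltr_pdivlMr.
apply/ffunP => a; apply/eqP; rewrite -subr_eq0; apply/eqP.
have := ce0 a; have := co0 a; rewrite /ce /co expr_i; case: (odd _) => /=.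
  by move=> /eqP; rewrite mulf_eq0 signr_eq0 orbF => /eqP.
by move=> _ /eqP; rewrite mulf_eq0 signr_eq0 orbF => /eqP.
Qed.
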